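(* There is an absolute constant $c>0$ such that the following holds. For any even $A\ge2$, any $S\ge1$, any $\eta>0$, and any $n>16SA\vee 4\eta^2SA$, and for any estimator $\hat\pi$ that maps a dataset of $n$ context-action-reward triples to a policy $\hat\pi\in\Delta(\mathcal A|\mathcal S)$ with full support, $$\sup_{\text{instances }(\mathcal S,\mathcal A,r,\rho,\pi^{\mathrm{ref}}):\ |\mathcal S|=S,\ |\mathcal A|=A}\ \mathbb E_{\mathcal D\sim P_{\pi^{\mathrm{ref}},r}}\big[\mathrm{SubOpt}(\hat\pi)\big]\ \ge\ c\,\frac{\eta SA}{n}.$$
   Context: An instance is an offline contextual bandit with finite context set $\mathcal S$, finite action set $\mathcal A$, mean reward $r:\mathcal S\times\mathcal A\to[0,1]$, context distribution $\rho\in\Delta(\mathcal S)$, and reference policy $\pi^{\mathrm{ref}}\in\Delta(\mathcal A|\mathcal S)$ with $\pi^{\mathrm{ref}}(a|s)>0$ for all $(s,a)$. The dataset $\mathcal D\sim P_{\pi^{\mathrm{ref}},r}$ consists of $n$ i.i.d. triples $(s_i,a_i,r_i)$ with $s_i\sim\rho$, $a_i\sim\pi^{\mathrm{ref}}(\cdot|s_i)$, $r_i=r(s_i,a_i)+\varepsilon_i$ with i.i.d. mean-zero $1$-subgaussian noise. For $\eta>0$, $J(\pi)=\mathbb E_{s\sim\rho}\big[\sum_a r(s,a)\pi(a|s)-\eta^{-1}\mathrm{KL}(\pi^{\mathrm{ref}}(\cdot|s)\|\pi(\cdot|s))\big]$, $\pi^*=\arg\max_\pi J(\pi)$, and $\mathrm{SubOpt}(\pi)=J(\pi^*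 )-J(\pi)$. *)

(* Defs.v *)
From HB Require Import structures.
From mathcomp Require Import all_boot all_order all_algebra.
From mathcomp Require Import all_classical all_reals all_analysis.
From mathcomp Require Import Rstruct Rstruct_topology.
From Stdlib Require Import Rdefinitions.

Set Implicit Arguments.
Unset Strict Implicit.
Unset Printing Implicit Defensive.

Import Order.TTheory GRing.Theory Num.Theory.
Import numFieldNormedType.Exports.
Local Open Scope ring_scope.
Local Open Scope classical_set_scope.

(* Context set = 'I_S, action set = 'I_A.  A (conditional) policy / kernel
   Delta(A|S) is represented by a function  'I_S -> 'I_A -> R. *)
Definition policy (S A : nat) := 'I_S -> 'I_A -> R.

Definition is_policy {S A : nat} (pi : policy S A) : Prop :=
  (forall s a, 0 <= pi s a) /\ (forall s, \sum_(a < A) pi s a = 1).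

Definition full_support {S A : nat} (pi : policy S A) : Prop :=
  is_policy pi /\ (forall s a, 0 < pi s a).

Definition is_distr {S : nat} (rho : 'I_S -> R) : Prop :=
  (forall s, 0 <= rho s) /\ \sum_(s < S) rho s = 1.

Definition KL {A : nat} (p q : 'I_A -> R) : R :=
  \sum_(a < A) p a * ln (p a / q a).

Definition Jobj {S A : nat} (eta : R) (r : 'I_S -> 'I_A -> R) (rho : 'I_S -> R)
    (piref : policy S A) (pi : policy S A) : R :=
  \sum_(s < S) rho s *
     (\sum_(a < A) r s a * pi s a - eta^-1 * KL (piref s) (pi s)).

(* J(pi_star) = max_pi J(pi); the maximiser exists and has full support, so
   J(pi_star) is the supremum of J over full-support policies. *)
Definition Jopt {S A : nat} (eta : R) (r : 'I_S -> 'I_A -> R) (rho : 'I_S -> R)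
    (piref : policy S A) : R :=
  sup [set Jobj eta r rho piref pi | pi in [set pi : policy S A | full_support pi]].

Definition SubOpt {S A : nat} (eta : R) (r : 'I_S -> 'I_A -> R) (rho : 'I_S -> R)
    (piref : policy S A) (pi : policy S A) : R :=
  Jopt eta r rho piref - Jobj eta r rho piref pi.

Definition sample (S A : nat) : Type := ('I_S * 'I_A * R)%type.

Definition subgaussian1 (nu : probability (measurableTypeR R) R) : Prop :=
  nu.-integrable setT (fun x : R => x%:E) /\
  (\int[nu]_x (x%:E) = 0)%E /\
  (forall lam : R, (\int[nu]_x (expR (lam * x))%:E <= (expR (lam ^+ 2 / 2))%:E)%E).

(* Expectation of f(D) for D ~ P_{piref,r}: k i.i.d. samples
   s_i ~ rho, a_i ~ piref(.|s_i), r_i = r(s_i,a_i) + eps_i, eps_i ~ nu.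
   Written as the iterated expectation over the k independent samples. *)
Fixpoint data_expect {S A : nat} (r : 'I_S -> 'I_A -> R) (rho : 'I_S -> R)
    (piref : policy S A) (nu : probability (measurableTypeR R) R) (k : nat)
    (f : seq (sample S A) -> \bar R) {struct k} : \bar R :=
  match k with
  | 0 => f [::]
  | k'.+1 =>
      (\sum_(s < S) \sum_(a < A) (rho s * piref s a)%:E *
         \int[nu]_e data_expect r rho piref nu k'
                      (fun D => f ((s, a, (r s a + e)%R) :: D)))%E
  end.

Definition mk_data {S A n : nat} (s : n.-tuple 'I_S) (a : n.-tuple 'I_A)
    (y : n.-tuple R) : seq (sample S A) :=
  [seq (tnth s i, tnth a i, tnth y i) | i <- enum 'I_n].

(* An estimator on datasets of size n: outputs a full-support policy, and
   (standing measurability convention) is measurable in the observed rewards. *)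
Definition valid_estimator {S A : nat} (n : nat)
    (est : seq (sample S A) -> policy S A) : Prop :=
  (forall D, size D = n -> full_support (est D)) /\
  (forall (s : n.-tuple 'I_S) (a : n.-tuple 'I_A) (s0 : 'I_S) (a0 : 'I_A),
      measurable_fun setT (fun y : n.-tuple (measurableTypeR R) => (est (mk_data s a y) s0 a0 : measurableTypeR R))).

Definition valid_instance {S A : nat} (r : 'I_S -> 'I_A -> R) (rho : 'I_S -> R)
    (piref : policy S A) (nu : probability (measurableTypeR R) R) : Prop :=
  (forall s a, 0 <= r s a <= 1) /\ is_distr rho /\ full_support piref /\
  subgaussian1 nu.

Definition expected_subopt {S A : nat} (eta : R) (n : nat)
    (est : seq (sample S A) -> policy S A)
    (r : 'I_S -> 'I_A -> R) (rho : 'I_S -> R) (piref : policy S A)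
    (nu : probability (measurableTypeR R) R) : \bar R :=
  data_expect r rho piref nu n (fun D => (SubOpt eta r rho piref (est D))%:E).

(* Main.v *)
Require Import Defs.
From HB Require Import structures.
From mathcomp Require Import all_boot all_order all_algebra.
From mathcomp Require Import all_classical all_reals all_analysis.
From mathcomp Require Import Rstruct Rstruct_topology.
From mathcomp Require Import measurable_realfun.
From mathcomp Require Import lra ring zify.
From Stdlib Require Import Rdefinitions.

Set Implicit Arguments.
Unset Strict Implicit.
Unset Printing Implicit Defensive.

Import Order.TTheory GRing.Theory Num.Theory.
Local Open Scope ring_scope.
Local Open Scope classical_set_scope.

(** Take uniform contexts and reference actions and mean rewards [1/2 + gap] or [1/2 - gap],
    with opposite signs inside each pair of actions. Then the optimal policy is explicit,
    [pi = 1 / (A g)] with [g = L -+ eta gap], and the suboptimality of any policy is exactly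
    the average of [phi (A pi g) / eta], [phi x = x - 1 - ln x]. No single value of [pi s a]
    makes both signs cheap: the two losses add up to at least [(eta gap / L)^2].

    The noise law is part of the instance, so it is chosen discrete: the squares of a tent
    function on a lattice of step [2 gap], supported in [[-1/2, 1/2]]. Changing a sign shifts
    the rewards by one lattice step, which costs only [O(gap^2)] in Hellinger affinity
    because the square root of the law is Lipschitz. Every expectation is bounded below by a
    finite sum over the atoms, so Assouad's argument becomes an induction on the sample
    size, and [gap^2] of order [S A / n] gives the rate. *)

(** * Integration against finitely supported laws *)

(* Without measurability, unlike [ge0_le_integral]: measurability of the iterated integrands of
   [data_expect] never has to be established. *)
Lemma ge0_integral_mono (R : realType) (d : measure_display) (T : measurableType d)
    (mu : {measure set T -> \bar R}) (f g : T -> \bar R) :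
  (forall x, 0 <= f x)%E -> (forall x, f x <= g x)%E ->
  (\int[mu]_x f x <= \int[mu]_x g x)%E.
Proof.
move=> f0 fg.
have g0 x : (0 <= g x)%E by exact: le_trans (f0 x) (fg x).
rewrite !ge0_integralTE//; apply: le_ereal_sup => _ [h hf <-].
by exists h => // x; apply: le_trans (hf x) (fg x).
Qed.

Section DiscreteNoise.
Context (d : measure_display) (T : measurableType d) (R : realType).
Context (N : nat) (e : 'I_N -> T) (p : 'I_N -> R).
Context (p_ge0 : forall i, 0 <= p i) (p_sum1 : \sum_i p i = 1).

(** [msum] takes a sequence of measures indexed by [nat], hence the padding by [mzero] beyond
    [N]. *)
Let atom_measure (k : nat) : {measure set T -> \bar R} :=
  if insub k is Some i
  then mscale (NngNum (p_ge0 i)) (dirac (e i)) else mzero.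

Definition discrete_law : set T -> \bar R := msum atom_measure N.

HB.instance Definition _ := Measure.on discrete_law.

Let discrete_lawT : discrete_law setT = 1%E.
Proof.
transitivity (\sum_i (p i)%:E)%E; last by rewrite sumEFin p_sum1.
apply: eq_bigr => i _; rewrite /atom_measure valK/=.
by rewrite /mscale/= diracT mule1.
Qed.

HB.instance Definition _ :=
  Measure_isProbability.Build _ _ _ discrete_law discrete_lawT.

Definition discrete_probability : probability T R := discrete_law.

Lemma ge0_integral_discrete_law (f : T -> \bar R) :
  measurable_fun setT f -> (forall x, 0 <= f x)%E ->
  (\int[discrete_probability]_x f x = \sum_i (p i)%:E * f (e i))%E.
Proof.
move=> mf f0; rewrite /discrete_probability /discrete_law ge0_integral_measure_sum//.
apply: eq_bigr => i _; rewrite /atom_measure valK.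
by rewrite ge0_integral_mscale//= integral_dirac// diracT mul1e.
Qed.

Lemma integral_discrete_law (f : T -> \bar R) :
  measurable_fun setT f -> (forall i, f (e i) \is a fin_num) ->
  (discrete_probability.-integrable setT f /\
   \int[discrete_probability]_x f x = \sum_i (p i)%:E * f (e i))%E.
Proof.
move=> mf ffin; split.
  apply/integrableP; split => //.
  rewrite ge0_integral_discrete_law//; last exact: measurableT_comp.
  rewrite -ge0_fin_numE; last by apply: sume_ge0 => i _; rewrite mule_ge0// lee_fin.
  by apply/sum_fin_numP => i _ _; rewrite fin_numM//= abse_fin_num.
rewrite integralE !ge0_integral_discrete_law//; last 2 first.
- exact: measurable_funeneg.
- exact: measurable_funepos.
have fp i : (f^\+ (e i))%E \is a fin_num by rewrite funeposE maxEle; case: ifP.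
have fn i : (f^\- (e i))%E \is a fin_num.
  by rewrite funenegE maxEle; case: ifP => // _; rewrite fin_numN.
transitivity (\sum_i ((p i)%:E * f^\+ (e i) - (p i)%:E * f^\- (e i)))%E.
  rewrite big_split/= fin_num_sumeN// => i _; exact: fin_numM.
apply: eq_bigr => i _; rewrite [in RHS](funeposneg f) muleBr//; exact: fin_num_adde_defr.
Qed.

(** Since [g] is arbitrary, it is compared with the simple function [h], equal to [f] on the atoms
    and zero elsewhere, which is measurable and integrates exactly. Injectivity of [e] gives [h] the
    right values. *)
Lemma integral_discrete_law_ge (f : T -> R) (g : T -> \bar R) :
  injective e -> (forall i, measurable [set e i]) ->
  (forall x, 0 <= f x) -> (forall x, (f x)%:E <= g x)%E ->
  ((\sum_i p i * f (e i))%:E <= \int[discrete_probability]_x g x)%E.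
Proof.
move=> e_inj e_meas f0 fg.
pose h (x : T) : R := \sum_i f (e i) * \1_[set e i] x.
have h0 x : 0 <= h x by apply: sumr_ge0 => i _; rewrite mulr_ge0// indicE.
have he i : h (e i) = f (e i).
  rewrite /h (bigD1 i)//= big1 ?addr0; first by rewrite indicE mem_set// mulr1.
  by move=> j ji; rewrite indicE memNset ?mulr0//= => /e_inj/esym/eqP; exact/negP.
have hg x : ((h x)%:E <= g x)%E.
  have [[i <-]|nx] := pselect (exists i, e i = x); first by rewrite he.
  apply: le_trans (fg x); rewrite lee_fin /h big1// => i _.
  by rewrite indicE memNset ?mulr0//= => xi; apply: nx; exists i.
apply: le_trans (ge0_integral_mono _ _ hg); last by move=> x; rewrite lee_fin.
rewrite ge0_integral_discrete_law.
- by rewrite -sumEFin; apply: lee_sum => i _; rewrite -EFinM he.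
- apply/measurable_EFinP; apply: measurable_sum => i.
  by apply: measurable_funM => //; exact: measurable_indic.
- by move=> x; rewrite lee_fin.
Qed.

End DiscreteNoise.

(** * Finite expectations and Hellinger affinity *)

Section FiniteExpectation.
Context {R : realType} {Z : finType} {X : Type} (obs : Z -> X).

(** [p] is the square root of the law of one sample, so that affinities are plain inner products. *)
Fixpoint finite_expect (p : Z -> R) (k : nat) (f : seq X -> R) : R :=
  if k is k'.+1
  then \sum_z p z ^+ 2 * finite_expect p k' (fun D => f (obs z :: D))
  else f [::].

Lemma finite_expect_ge0 (p : Z -> R) k (f : seq X -> R) :
  (forall D, size D = k -> 0 <= f D) -> 0 <= finite_expect p k f.
Proof.
elim: k f => [|k IH] f f0 /=; first exact: f0.
apply: sumr_ge0 => z _; rewrite mulr_ge0 ?sqr_ge0//.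
by apply: IH => D sD; apply: f0; rewrite /= sD.
Qed.

Lemma eq_finite_expect (p : Z -> R) k (f g : seq X -> R) :
  (forall D, size D = k -> f D = g D) -> finite_expect p k f = finite_expect p k g.
Proof.
elim: k f g => [|k IH] f g fg /=; first exact: fg.
apply: eq_bigr => z _; congr (_ * _).
by apply: IH => D sD; apply: fg; rewrite /= sD.
Qed.

Lemma finite_expectZ (p : Z -> R) k (c : R) (f : seq X -> R) :
  finite_expect p k (fun D => c * f D) = c * finite_expect p k f.
Proof.
elim: k f => [//|k IH] f /=; rewrite mulr_sumr.
by apply: eq_bigr => z _; rewrite IH mulrCA.
Qed.

Lemma finite_expect_sum (I : finType) (p : Z -> R) k (f : I -> seq X -> R) :
  finite_expect p k (fun D => \sum_i f i D) = \sum_i finite_expect p k (f i).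
Proof.
elim: k f => [//|k IH] f /=; rewrite exchange_big/=.
by apply: eq_bigr => z _; rewrite IH mulr_sumr.
Qed.

(* The base case is [min (a^2) (b^2) >= a b - (a^2 + b^2) / 4]; carrying the square
   roots [a], [b] of the likelihoods makes the bound tensorize. *)
Lemma hellinger_two_point (p q : Z -> R) (d a b : R) k (f g : seq X -> R) :
  \sum_z p z ^+ 2 = 1 -> \sum_z q z ^+ 2 = 1 ->
  0 <= d -> (forall D, size D = k -> [/\ 0 <= f D, 0 <= g D & d <= f D + g D]) ->
  d * (a * b * (\sum_z p z * q z) ^+ k - (a ^+ 2 + b ^+ 2) / 4) <=
  a ^+ 2 * finite_expect p k f + b ^+ 2 * finite_expect q k g.
Proof.
move=> p1 q1 d0; elim: k a b f g => [|k IH] a b f g fg /=.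
  have [f0 g0 dfg] := fg [::] erefl; rewrite expr0 mulr1.
  have [ab|/ltW ba] := leP (a ^+ 2) (b ^+ 2).
    apply: (@le_trans _ _ (a ^+ 2 * d)); last first.
      rewrite (le_trans (ler_wpM2l (sqr_ge0 a) dfg))// mulrDr lerD2l.
      by rewrite ler_wpM2r.
    rewrite mulrC ler_wpM2r//.
    have := sqr_ge0 (b / 2 - a); have := sqr_ge0 a; nra.
  apply: (@le_trans _ _ (b ^+ 2 * d)); last first.
    rewrite (le_trans (ler_wpM2l (sqr_ge0 b) dfg))// mulrDr lerD2r.
    by rewrite ler_wpM2r.
  rewrite mulrC ler_wpM2r//.
  have := sqr_ge0 (a / 2 - b); have := sqr_ge0 b; nra.
rewrite !mulr_sumr -big_split/=.
(* The left side is spread over the first sample [z]: its likelihood roots are absorbed into [a] and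
   [b], and the two normalizations distribute the quadratic terms. *)
have -> : d * (a * b * (\sum_z p z * q z) ^+ k.+1 - (a ^+ 2 + b ^+ 2) / 4) =
    \sum_z d * ((a * p z) * (b * q z) * (\sum_z p z * q z) ^+ k
                - ((a * p z) ^+ 2 + (b * q z) ^+ 2) / 4).
  rewrite -mulr_sumr sumrB; congr (_ * (_ - _)).
    by rewrite exprS mulrA mulr_sumr mulr_suml; apply: eq_bigr => z _; ring.
  rewrite -mulr_suml big_split/=; congr (_ / _).
  rewrite -[in LHS](mulr1 (a ^+ 2)) -[in LHS](mulr1 (b ^+ 2)) -{1}p1 -q1 !mulr_sumr.
  by congr (_ + _); apply: eq_bigr => z _; rewrite exprMn.
apply: ler_sum => z _.
have := IH (a * p z) (b * q z) (fun D => f (obs z :: D)) (fun D => g (obs z :: D)).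
rewrite !exprMn !mulrA; apply => D sD; apply: fg; rewrite /= sD//.
Qed.

End FiniteExpectation.

(** * Elementary real inequalities *)

Section RealInequalities.
Context {R : realType}.
Implicit Types x y t u L : R.

Lemma bernoulli_ineq x n : 0 <= x <= 1 -> 1 - n%:R * x <= (1 - x) ^+ n.
Proof.
move=> /andP[x0 x1]; elim: n => [|n IH]; first by rewrite mul0r expr0; lra.
rewrite exprS -natr1; apply: le_trans (ler_wpM2l _ IH); last lra.
have := mulr_ge0 (ler0n R n) (mulr_ge0 x0 x0); nra.
Qed.

Lemma ln_le_subr1 x : 0 < x -> ln x <= x - 1.
Proof.
move=> x0; have := @le_ln1Dx R (x - 1); rewrite [1 + _]addrC subrK; apply; lra.
Qed.

(** For [x >= 1 / 2] already [expR x <= expR (2 * x ^+ 2)]. For [0 <= x <= 1 / 2], tangent lines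
    bound the mean by [(1 - x ^+ 2)^-1], which is at most [1 + 2 * x ^+ 2]. *)
Lemma cosh_half_le x : (expR x + expR (- x)) / 2 <= expR (2 * x ^+ 2).
Proof.
wlog x0 : x / 0 <= x.
  move=> H; have [/H//|/ltW x0] := leP 0 x.
  by have := H (- x); rewrite opprK sqrrN addrC; apply; lra.
have e1 := expR_ge1Dx x; have e2 := expR_ge1Dx (- x).
have [x1|/ltW x1] := leP x (1 / 2); last first.
  apply: (@le_trans _ _ (expR x)).
    have : expR (- x) <= expR x by rewrite ler_expR; lra.
    lra.
  by rewrite ler_expR; nra.
apply: le_trans (expR_ge1Dx _).
have ee : expR x * expR (- x) = 1 by rewrite expRN mulfV// gt_eqF// expR_gt0.
have p1 := expR_gt0 x; have p2 := expR_gt0 (- x).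
have b1 : expR x * (1 - x) <= 1 by rewrite -{2}ee ler_wpM2l// ltW.
have b2 : expR (- x) * (1 + x) <= 1 by rewrite -{2}ee [X in _ <= X]mulrC ler_wpM2l// ltW.
have c1 : expR x <= (1 - x)^-1 by rewrite -[leRHS]mul1r ler_pdivlMr//; lra.
have c2 : expR (- x) <= (1 + x)^-1 by rewrite -[leRHS]mul1r ler_pdivlMr//; lra.
apply: (@le_trans _ _ (((1 - x)^-1 + (1 + x)^-1) / 2)); first lra.
have -> : ((1 - x)^-1 + (1 + x)^-1) / 2 = (1 - x ^+ 2)^-1.
  have n1 : 1 - x != 0 by rewrite gt_eqF//; lra.
  have n2 : 1 + x != 0 by rewrite gt_eqF//; lra.
  have -> : 1 - x ^+ 2 = (1 - x) * (1 + x) by ring.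
  by field; rewrite n1 n2.
rewrite -[leLHS]mul1r ler_pdivrMr; last nra.
have x2 : x ^+ 2 <= 1 / 4 by nra.
have := sqr_ge0 x; nra.
Qed.

(* Both losses vanish only at the distinct points [(L - u)^-1] and [(L + u)^-1]; the sum
   is minimal at [t = L^-1], where it equals [- ln (1 - u^2 / L^2)]. *)
Lemma two_point_separation t L u : 0 < t -> 0 < L -> 0 <= u < L ->
  u ^+ 2 / L ^+ 2 <=
  (t * (L - u) - 1 - ln (t * (L - u))) + (t * (L + u) - 1 - ln (t * (L + u))).
Proof.
move=> t0 L0 /andP[u0 uL].
have m1 : 0 < t * (L - u) by apply: mulr_gt0 => //; lra.
have m2 : 0 < t * (L + u) by apply: mulr_gt0 => //; lra.
have tL : 0 < t * L by exact: mulr_gt0.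
have L2 : 0 < L ^+ 2 by exact: exprn_gt0.
have v0 : 0 < 1 - u ^+ 2 / L ^+ 2.
  by rewrite subr_gt0 ltr_pdivrMr// mul1r; nra.
have e : ln (t * (L - u)) + ln (t * (L + u)) =
    ln (t * L) + ln (t * L) + ln (1 - u ^+ 2 / L ^+ 2).
  rewrite -[LHS]lnM ?posrE// -[X in _ = X + _]lnM ?posrE// -[RHS]lnM ?posrE//;
    last exact: mulr_gt0.
  congr ln.
  by field; rewrite gt_eqF.
have := ln_le_subr1 v0; have := ln_le_subr1 tL.
have -> : t * (L - u) = t * L - t * u by ring.
have -> : t * (L + u) = t * L + t * u by ring.
move: e; have -> : t * (L - u) = t * L - t * u by ring.
have -> : t * (L + u) = t * L + t * u by ring.
lra.
Qed.

(** Supplies the lattice size: truncating [Num.sqrt x] and adding [1] gives at most twice the root,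
    as [x >= 1]. *)
Lemma nat_square_between x : 1 <= x -> exists2 m : nat, (0 < m)%nat & x <= m%:R ^+ 2 <= 4 * x.
Proof.
move=> x1; pose s := Num.sqrt x; have s1 : 1 <= s by rewrite -sqrtr1 ler_sqrt//; lra.
have ss : s ^+ 2 = x by rewrite sqr_sqrtr//; lra.
exists (Num.truncn s).+1 => //.
have /andP[a b] := truncn_itv (le_trans ler01 s1).
have c : (Num.truncn s).+1%:R <= s + 1 by rewrite -natr1 lerD2r.
by apply/andP; split; nra.
Qed.

End RealInequalities.

(** * The tent noise *)

Lemma measurable_expRM (R : realType) (lam : R) :
  measurable_fun setT (fun x : measurableTypeR R => expR (lam * x)).
Proof. by apply: measurableT_comp => //; apply: measurable_funM. Qed.

(** The reflection [s] cancels the mean and symmetrizes the exponential moment; [cosh_half_le] then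
    gives the exponent [2 * (lam * e i) ^+ 2], at most [lam ^+ 2 / 2] because
    [e i ^+ 2 <= 1 / 4]. *)
Lemma subgaussian1_symmetric (N : nat) (e p : 'I_N -> R) (s : 'I_N -> 'I_N)
    (p_ge0 : forall i, 0 <= p i) (p_sum1 : \sum_i p i = 1) :
  involutive s -> (forall i, p (s i) = p i) -> (forall i, e (s i) = - e i) ->
  (forall i, `|e i| <= 1 / 2) ->
  subgaussian1 (discrete_probability (e : 'I_N -> measurableTypeR R) p_ge0 p_sum1).
Proof.
move=> sK ps es e2.
have sI : injective s by exact: can_inj sK.
have e2' i : (e i) ^+ 2 <= 1 / 4.
  by have := e2 i; rewrite ler_norml => /andP[? ?]; nra.
have [||int1 E1] := @integral_discrete_law _ (measurableTypeR R) _ _ e p p_ge0 p_sum1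
  (fun x : measurableTypeR R => (x : R)%:E).
- by apply/measurable_EFinP.
- by [].
split; first exact: int1.
split.
  rewrite E1; under eq_bigr do rewrite -EFinM.
  rewrite sumEFin; congr EFin.
  have : \sum_i p i * e i = - \sum_i p i * e i.
    rewrite {1}(reindex_inj sI)/= -sumrN; apply: eq_bigr => i _.
    by rewrite ps es mulrN.
  lra.
move=> lam; rewrite ge0_integral_discrete_law; last 2 first.
- by apply/measurable_EFinP; exact: measurable_expRM.
- by move=> x; rewrite lee_fin expR_ge0.
under eq_bigr do rewrite -EFinM.
rewrite sumEFin lee_fin.
have -> : \sum_i p i * expR (lam * e i) =
    \sum_i p i * ((expR (lam * e i) + expR (- (lam * e i))) / 2).
  have h : \sum_i p i * expR (lam * e i) = \sum_i p i * expR (- (lam * e i)).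
    rewrite {1}(reindex_inj sI)/=; apply: eq_bigr => i _.
    by rewrite ps es mulrN.
  transitivity ((\sum_i p i * expR (lam * e i) + \sum_i p i * expR (- (lam * e i))) / 2).
    by rewrite -h; lra.
  by rewrite -big_split/= mulr_suml; apply: eq_bigr => i _; rewrite -mulrDr mulrA.
rewrite -[leRHS]mul1r -[X in _ <= X * _]p_sum1 mulr_suml; apply: ler_sum => i _.
apply: ler_wpM2l => //; apply: le_trans (cosh_half_le _) _.
by rewrite ler_expR exprMn; have := e2' i; have := sqr_ge0 lam; nra.
Qed.

Lemma sum_nat_squares (R : realType) n :
  \sum_(i < n) (i%:R : R) ^+ 2 = n%:R * (n%:R - 1) * (2 * n%:R - 1) / 6.
Proof.
elim: n => [|n IH]; first by rewrite big_ord0 !mul0r.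
by rewrite big_ord_recr/= IH -natr1; field.
Qed.

Section TentNoise.
Context {R : realType} (M : nat) (M_gt0 : (0 < M)%nat).

(** The peak is at [M]. Truncated subtraction gives zero at every index from [M + M] on, so the
    index may run past the support. *)
Definition tent (i : nat) : nat := minn i (M + M - i).

Definition tent_mass : R := \sum_(i < M + M.+1) (tent i)%:R ^+ 2.

Lemma tent_massE : tent_mass = M%:R * (2 * M%:R ^+ 2 + 1) / 3.
Proof.
(* Split at the peak; reversing the right half turns both halves into sums of consecutive
   squares. *)
rewrite /tent_mass big_split_ord/=.
rewrite (eq_bigr (fun i : 'I_M => (i%:R : R) ^+ 2)); last first.
  by move=> i _; congr (_%:R ^+ 2); rewrite /tent; have := ltn_ord i; lia.
rewrite [X in _ + X](reindex_inj rev_ord_inj)/=.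
rewrite (eq_bigr (fun i : 'I_M.+1 => (i%:R : R) ^+ 2)); last first.
  by move=> i _; congr (_%:R ^+ 2); rewrite /tent; have := ltn_ord i; lia.
by rewrite !sum_nat_squares -natr1; field.
Qed.

Let M_gt0R : 0 < M%:R :> R. Proof. by rewrite ltr0n. Qed.

Lemma tent_mass_gt0 : 0 < tent_mass.
Proof.
rewrite tent_massE; have := exprn_gt0 2 M_gt0R => M2.
by rewrite divr_gt0 ?mulr_gt0//; lra.
Qed.

Definition tent_root (i : nat) : R := (tent i)%:R / Num.sqrt tent_mass.

Lemma sqr_tent_root i : tent_root i ^+ 2 = (tent i)%:R ^+ 2 / tent_mass.
Proof. by rewrite expr_div_n sqr_sqrtr// ltW// tent_mass_gt0. Qed.

Lemma tent_root_sym (i : 'I_(M + M.+1)) : tent_root (rev_ord i) = tent_root i.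
Proof. by rewrite /tent_root; congr (_%:R / _); rewrite /tent/=; have := ltn_ord i; lia. Qed.

Lemma sum_tent_root : \sum_(i < M + M.+1) tent_root i ^+ 2 = 1.
Proof.
under eq_bigr do rewrite sqr_tent_root.
by rewrite -mulr_suml divff// gt_eqF// tent_mass_gt0.
Qed.

(** With [tent_root_last], the boundary terms on the extended lattice of [2 M + 2] points: index [0]
    of the shifted sequence, and the last index of the unshifted one. *)
Lemma tent_root_pred0 : tent_root 0.-1 = 0.
Proof. by rewrite /tent_root /tent min0n mul0r. Qed.

Lemma tent_root_last : tent_root (M + M.+1) = 0.
Proof. by rewrite /tent_root (_ : tent _ = 0%nat) ?mul0r// /tent; lia. Qed.

(** For unit vectors, [2 - 2 <p, q>] is the squared distance. The tent has [2 M] unit increments, so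
    this is [2 M / tent_mass], and the mass is at least [2 M^3 / 3]. *)
Lemma tent_root_affinity :
  1 - 3 / 2 / M%:R ^+ 2 <= \sum_(i < (M + M.+1).+1) tent_root i * tent_root i.-1.
Proof.
have sq : \sum_(i < (M + M.+1).+1) (tent_root i - tent_root i.-1) ^+ 2
    = 2 * M%:R / tent_mass.
  (* Index [0] contributes nothing because [0.-1 = 0]; later increments of the tent are [1] or [-1],
     except the last, which joins two zeros. *)
  rewrite big_ord_recl/= subrr expr0n/= add0r.
  rewrite (eq_bigr (fun i : 'I_(M + M.+1) => (i < M + M)%nat%:R / tent_mass)); last first.
    move=> i _; rewrite /bump/= /tent_root -mulrBl expr_div_n sqr_sqrtr; last first.
      by rewrite ltW// tent_mass_gt0.
    congr (_ / _); rewrite add1n /tent.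
    case: (ltnP i (M + M)) => h.
      have [h'|h'] := ltnP i M.
        rewrite !(minn_idPl _); [|lia|lia].
        by rewrite -natr1 addrAC subrr add0r expr1n.
      rewrite !(minn_idPr _); [|lia|lia].
      have -> : (M + M - i = (M + M - i.+1).+1)%nat by lia.
      by rewrite -natr1 opprD addrA subrr add0r sqrrN expr1n.
    have -> : minn i.+1 (M + M - i.+1) = 0%nat by lia.
    have -> : minn i (M + M - i) = 0%nat by lia.
    by rewrite subrr expr0n.
  rewrite -mulr_suml addnS big_ord_recr/= ltnn addr0; congr (_ / _).
  rewrite (eq_bigr (fun=> 1)) => [|i _]; last by rewrite /= ltn_ord.
  by rewrite sumr_const card_ord natrD; lra.
have s1 : \sum_(i < (M + M.+1).+1) tent_root i ^+ 2 = 1.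
  by rewrite big_ord_recr/= tent_root_last expr0n/= addr0 sum_tent_root.
have s2 : \sum_(i < (M + M.+1).+1) tent_root i.-1 ^+ 2 = 1.
  by rewrite big_ord_recl/= tent_root_pred0 expr0n/= add0r sum_tent_root.
have e : \sum_(i < (M + M.+1).+1) (tent_root i - tent_root i.-1) ^+ 2 =
    2 - 2 * \sum_(i < (M + M.+1).+1) tent_root i * tent_root i.-1.
  rewrite mulr_sumr.
  transitivity (\sum_(i < (M + M.+1).+1) (tent_root i ^+ 2 + tent_root i.-1 ^+ 2)
      - \sum_(i < (M + M.+1).+1) 2 * (tent_root i * tent_root i.-1)).
    by rewrite -sumrB; apply: eq_bigr => i _; ring.
  by rewrite big_split/= s1 s2; lra.
have : M%:R / tent_mass <= 3 / 2 / M%:R ^+ 2.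
  rewrite ler_pdivrMr ?tent_mass_gt0// tent_massE.
  rewrite [leRHS](_ : _ = M%:R + (2 * M%:R)^-1); last by field; rewrite gt_eqF.
  by rewrite lerDl invr_ge0 mulr_ge0.
move: e; rewrite sq -mulrA; lra.
Qed.

End TentNoise.

(** * The regularized objective with uniform reference *)

Definition phi (R : realType) (x : R) : R := x - 1 - ln x.

Lemma phi_ge0 (R : realType) (x : R) : 0 < x -> 0 <= phi x.
Proof. by move=> x0; have := ln_le_subr1 x0; rewrite /phi; lra. Qed.

Definition unif (n : nat) : 'I_n -> R := fun=> n%:R^-1.
Arguments unif : clear implicits.

Section UniformReference.
Context (S A : nat) (S_gt0 : (0 < S)%nat) (A_gt0 : (0 < A)%nat).
Context (eta kappa : R) (eta_gt0 : 0 < eta).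
Context (g : 'I_S -> 'I_A -> R) (g_gt0 : forall s a, 0 < g s a).
Context (r : 'I_S -> 'I_A -> R) (rE : forall s a, r s a = kappa - g s a / eta).

Let S_gt0R : 0 < S%:R :> R. Proof. by rewrite ltr0n. Qed.
Let A_gt0R : 0 < A%:R :> R. Proof. by rewrite ltr0n. Qed.

(* The first-order condition makes [kappa] the Lagrange multiplier and [1 / (A g)] the optimal
   policy; the remainder is the Bregman divergence to it. *)
Lemma Jobj_uniform (pi : policy S A) : full_support pi ->
  Jobj eta r (unif S) (fun=> unif A) pi =
  kappa - eta^-1 - (eta * S%:R * A%:R)^-1 * (\sum_s \sum_a ln (g s a))
  - (eta * S%:R * A%:R)^-1 * (\sum_s \sum_a phi (A%:R * pi s a * g s a)).
Proof.
move=> [[pi_ge0 pi_sum] pi_gt0].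
rewrite /Jobj /unif.
have n1 : eta != 0 by rewrite gt_eqF.
have n2 : S%:R != 0 :> R by rewrite gt_eqF.
have n3 : A%:R != 0 :> R by rewrite gt_eqF.
have row s : \sum_(a < A) r s a * pi s a - eta^-1 * KL (fun=> A%:R^-1) (pi s) =
    kappa - eta^-1 - (eta * A%:R)^-1 * (\sum_a ln (g s a))
    - (eta * A%:R)^-1 * (\sum_a phi (A%:R * pi s a * g s a)).
  have -> : \sum_(a < A) r s a * pi s a = kappa - eta^-1 * \sum_a g s a * pi s a.
    rewrite -[X in X - _]mulr1 -(pi_sum s) !mulr_sumr -sumrB.
    by apply: eq_bigr => a _; rewrite rE; ring.
  have -> : KL (fun=> A%:R^-1) (pi s) =
      A%:R^-1 * (\sum_a (ln (g s a) - ln (A%:R * pi s a * g s a))).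
    rewrite /KL mulr_sumr; apply: eq_bigr => a _; congr (_ * _).
    have q := pi_gt0 s a; have k := g_gt0 s a.
    rewrite !lnM ?posrE ?mulr_gt0 ?invr_gt0// !lnV ?posrE//; ring.
  have -> : \sum_a phi (A%:R * pi s a * g s a) =
      A%:R * (\sum_a g s a * pi s a) - A%:R - \sum_a ln (A%:R * pi s a * g s a).
    rewrite /phi !sumrB sumr_const card_ord; congr (_ - _ - _).
    by rewrite mulr_sumr; apply: eq_bigr => a _; ring.
  by rewrite sumrB; field; rewrite n1 n3.
under eq_bigr do rewrite row.
rewrite -mulr_sumr !sumrB !sumr_const card_ord -!mulr_sumr.
rewrite -[kappa *+ S]mulr_natr -[eta^-1 *+ S]mulr_natr.
by field; rewrite n1 n2 n3.
Qed.

(** The normalization of [g] makes [(A g)^-1] a policy; there every [phi] is [phi 1 = 0], so the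
    constant part of [Jobj_uniform] is the maximum. *)
Lemma SubOpt_uniform (pi : policy S A) :
  (forall s, \sum_a (A%:R * g s a)^-1 = 1) -> full_support pi ->
  SubOpt eta r (unif S) (fun=> unif A) pi =
  (eta * S%:R * A%:R)^-1 * (\sum_s \sum_a phi (A%:R * pi s a * g s a)).
Proof.
move=> g_sum pi_fs; rewrite /SubOpt (Jobj_uniform pi_fs) /Jopt.
set C := kappa - _ - _.
pose pistar : policy S A := fun s a => (A%:R * g s a)^-1.
have star_gt0 s a : 0 < pistar s a by rewrite invr_gt0 mulr_gt0.
have star_fs : full_support pistar by split => //; split => // s a; exact: ltW.
have star_J : Jobj eta r (unif S) (fun=> unif A) pistar = C.
  have z : \sum_s \sum_a phi (A%:R * pistar s a * g s a) = 0.
    apply: big1 => s _; apply: big1 => a _; rewrite /pistar /phi.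
    have -> : A%:R * (A%:R * g s a)^-1 * g s a = 1 by field; rewrite !gt_eqF.
    by rewrite subrr ln1 subr0.
  by rewrite (Jobj_uniform star_fs) z mulr0 subr0.
have le_C q : full_support q -> Jobj eta r (unif S) (fun=> unif A) q <= C.
  move=> q_fs; rewrite (Jobj_uniform q_fs) lerBlDr lerDl.
  rewrite mulr_ge0 ?invr_ge0 ?mulr_ge0//; first exact: ltW.
  apply: sumr_ge0 => s _; apply: sumr_ge0 => a _; apply: phi_ge0.
  by rewrite !mulr_gt0//; case: q_fs.
suff -> : sup [set Jobj eta r (unif S) (fun=> unif A) q |
                q in [set q : policy S A | full_support q]] = C.
  by rewrite RminusE opprB addrC subrK.
apply/eqP; rewrite eq_le; apply/andP; split.
  apply: ge_sup; first by exists C, pistar.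
  by move=> _ [q q_fs <-]; exact: le_C.
apply: ub_le_sup; last by exists pistar.
by exists C => _ [q q_fs <-]; exact: le_C.
Qed.

End UniformReference.

(** * Sign patterns and likelihoods *)

Section SignPatterns.
Context {S A : nat}.
Implicit Types (tau : {ffun 'I_S * 'I_A -> bool}) (s : 'I_S) (a : 'I_A).

(* The actions [a] and [rev_ord a] form a pair with opposite signs, so that the optimal
   multiplier does not depend on [tau]. *)
Definition sgn tau s a : bool :=
  tau (s, a) (+) tau (s, rev_ord a) (+) (a < rev_ord a)%nat.

(** For even [A], toggling one free bit reverses the signs of [a0] and [rev_ord a0] together, which
    keeps the pairs opposite. *)
Definition flip s0 a0 tau : {ffun 'I_S * 'I_A -> bool} :=
  [ffun x => tau x (+) (x == (s0, a0))].

Lemma rev_ord_neq a : ~~ odd A -> rev_ord a != a.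
Proof.
move=> oA; apply/negP => /eqP/(congr1 val)/= h.
move: oA; have -> : A = (a + a).+1 by have := ltn_ord a; lia.
by rewrite /= addnn odd_double.
Qed.

Lemma sgn_rev tau s a : ~~ odd A -> sgn tau s (rev_ord a) = ~~ sgn tau s a.
Proof.
move=> /(rev_ord_neq a) an; rewrite /sgn rev_ordK.
have -> : (rev_ord a < a)%nat = ~~ (a < rev_ord a)%nat.
  by rewrite -leqNgt ltn_neqAle an.
by case: (tau (s, a)); case: (tau (s, rev_ord a)); case: (a < rev_ord a)%nat.
Qed.

Lemma flipK s0 a0 : involutive (flip s0 a0).
Proof. by move=> tau; apply/ffunP => x; rewrite !ffunE -addbA addbb addbF. Qed.

Lemma sgn_flip s0 a0 tau s a : sgn (flip s0 a0 tau) s a =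
  sgn tau s a (+) ((s, a) == (s0, a0)) (+) ((s, rev_ord a) == (s0, a0)).
Proof.
rewrite /sgn !ffunE; case: (tau (s, a)); case: (tau (s, rev_ord a));
by case: (a < rev_ord a)%nat; case: ((s, a) == _); case: ((s, rev_ord a) == _).
Qed.

Lemma sgn_flip_self tau s a : ~~ odd A -> sgn (flip s a tau) s a = ~~ sgn tau s a.
Proof.
move=> /(rev_ord_neq a) an; rewrite sgn_flip eqxx xpair_eqE eqxx (negbTE an)/=.
by rewrite addbF addbT.
Qed.

End SignPatterns.

Section Likelihood.
Context {R : realType} {S A : nat} (M : nat).
Context (S_gt0 : (0 < S)%nat) (A_gt0 : (0 < A)%nat) (M_gt0 : (0 < M)%nat).
Implicit Types (tau : {ffun 'I_S * 'I_A -> bool}).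

(** Square root of the likelihood of one observation: a positive sign moves the tent up by one
    index. Truncation of the predecessor at [0] is harmless, as the tent vanishes there. *)
Definition root tau (z : 'I_S * 'I_A * 'I_(M + M.+1).+1) : R :=
  Num.sqrt (S%:R^-1 * A%:R^-1) *
  (if sgn tau z.1.1 z.1.2 then tent_root M z.2.-1 else tent_root M z.2).

Let w_ge0 : 0 <= S%:R^-1 * A%:R^-1 :> R.
Proof. by rewrite mulr_ge0. Qed.

Lemma sum_uniform (c : R) :
  \sum_(s < S) \sum_(a < A) S%:R^-1 * A%:R^-1 * c = c.
Proof.
rewrite !(sumr_const, card_ord) -mulrnA -[LHS]mulr_natr natrM.
by field; rewrite !pnatr_eq0 -!lt0n S_gt0 A_gt0.
Qed.

Lemma sum_sqr_root tau : \sum_z root tau z ^+ 2 = 1.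
Proof.
rewrite -(pair_bigA _ (fun sa i => root tau (sa, i) ^+ 2))/=.
rewrite -(pair_bigA _ (fun s a => \sum_i root tau (s, a, i) ^+ 2))/=.
rewrite -[RHS](sum_uniform 1); apply: eq_bigr => s _; apply: eq_bigr => a _.
under eq_bigr do rewrite /root exprMn sqr_sqrtr//.
rewrite -mulr_sumr; congr (_ * _); rewrite /=; case: (sgn tau s a).
  by rewrite big_ord_recl/= tent_root_pred0 expr0n/= add0r sum_tent_root.
by rewrite big_ord_recr/= tent_root_last// expr0n/= addr0 sum_tent_root.
Qed.

(** Only the cells [(s0, a0)] and [(s0, rev_ord a0)] change; each has weight [1 / (S A)] and loses
    at most [3 / (2 M^2)]. *)
Lemma root_affinity tau s0 a0 :
  1 - 3 / (M%:R ^+ 2 * S%:R * A%:R) <= \sum_z root tau z * root (flip s0 a0 tau) z.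
Proof.
set bc : R := 1 - 3 / 2 / M%:R ^+ 2.
have bc_le1 : bc <= 1 by rewrite lerBlDr lerDl !divr_ge0// sqr_ge0.
rewrite -(pair_bigA _ (fun sa i => root tau (sa, i) * root (flip s0 a0 tau) (sa, i)))/=.
rewrite -(pair_bigA _ (fun s a =>
  \sum_i root tau (s, a, i) * root (flip s0 a0 tau) (s, a, i)))/=.
have point (x0 : 'I_S * 'I_A) : \sum_(s < S) \sum_(a < A) ((s, a) == x0)%:R = 1 :> R.
  rewrite (pair_bigA _ (fun s a => ((s, a) == x0)%:R)) (bigD1 x0)//=.
  rewrite -surjective_pairing eqxx big1 ?addr0// => x /negbTE.
  by rewrite -surjective_pairing => ->.
have -> : 1 - 3 / (M%:R ^+ 2 * S%:R * A%:R) = \sum_(s < S) \sum_(a < A)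
    S%:R^-1 * A%:R^-1 * (1 - (1 - bc) * (((s, a) == (s0, a0))%:R
                                         + ((s, a) == (s0, rev_ord a0))%:R)).
  have two : \sum_(s < S) \sum_(a < A) (((s, a) == (s0, a0))%:R
      + ((s, a) == (s0, rev_ord a0))%:R) = 2 :> R.
    by under eq_bigr do rewrite big_split/=; rewrite big_split/= !point.
  transitivity (\sum_(s < S) \sum_(a < A) S%:R^-1 * A%:R^-1 * 1
      - S%:R^-1 * A%:R^-1 * (1 - bc) * \sum_(s < S) \sum_(a < A)
        (((s, a) == (s0, a0))%:R + ((s, a) == (s0, rev_ord a0))%:R)).
    rewrite sum_uniform two /bc.
    by field; rewrite !pnatr_eq0 -!lt0n S_gt0 A_gt0 M_gt0.
  rewrite mulr_sumr -sumrB; apply: eq_bigr => s _.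
  by rewrite mulr_sumr -sumrB; apply: eq_bigr => a _; ring.
apply: ler_sum => s _; apply: ler_sum => a _.
under eq_bigr do rewrite /root mulrACA -expr2 sqr_sqrtr//.
rewrite -mulr_sumr; apply: ler_wpM2l => //=.
have aff := @tent_root_affinity R _ M_gt0.
have aff' : bc <= \sum_(i < (M + M.+1).+1) tent_root M i.-1 * tent_root M i.
  by apply: le_trans aff _; apply: ler_sum => i _; rewrite mulrC.
have one b : \sum_(i < (M + M.+1).+1) (if b then tent_root M i.-1 else tent_root M i)
    * (if b then tent_root M i.-1 else tent_root M i) = 1 :> R.
  case: b.
    under eq_bigr do rewrite -expr2.
    by rewrite big_ord_recl/= tent_root_pred0 expr0n/= add0r sum_tent_root.
  under eq_bigr do rewrite -expr2.
  by rewrite big_ord_recr/= tent_root_last// expr0n/= addr0 sum_tent_root.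
have flipped b : bc <= \sum_(i < (M + M.+1).+1) (if b then tent_root M i.-1 else tent_root M i)
    * (if ~~ b then tent_root M i.-1 else tent_root M i).
  by case: b.
rewrite sgn_flip.
have -> : ((s, a) == (s0, rev_ord a0)) = ((s, rev_ord a) == (s0, a0)).
  by rewrite !xpair_eqE; congr (_ && _); rewrite -(inj_eq rev_ord_inj) rev_ordK.
(* If both indicators hold, the sign is reversed twice and the cell keeps affinity [1]. *)
case: ((s, a) == _); case: ((s, rev_ord a) == _); rewrite ?addbT ?addbF/=.
- by rewrite negbK one; lra.
- by apply: le_trans (flipped _); lra.
- by apply: le_trans (flipped _); lra.
- by rewrite one; lra.
Qed.

End Likelihood.

Arguments root {R S A} M tau z.

(** * Hard instances *)

Section HardInstances.
Context {S A : nat} (M : nat).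
Context (S_gt0 : (0 < S)%nat) (A_gt0 : (0 < A)%nat) (M_gt0 : (0 < M)%nat).
Implicit Types (tau : {ffun 'I_S * 'I_A -> bool}).

(* The two possible mean rewards [1/2 + gap] and [1/2 - gap] differ by one lattice step of the
   noise, so both hypotheses charge the same reward lattice. *)
Definition gap {T : realType} : T := (4 * M%:R)^-1.

Definition noise_atom {T : realType} (i : 'I_(M + M.+1)) : T :=
  (i%:R - M%:R) * (2 * gap).

Definition lattice {T : realType} (i : nat) : T :=
  1 / 2 - gap + (i%:R - M%:R) * (2 * gap).

Definition reward {T : realType} tau (s : 'I_S) (a : 'I_A) : T :=
  if sgn tau s a then 1 / 2 + gap else 1 / 2 - gap.

Definition observation (z : 'I_S * 'I_A * 'I_(M + M.+1).+1) : sample S A :=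
  (z.1.1, z.1.2, lattice z.2).

Definition noise : probability (measurableTypeR R) R :=
  discrete_probability (noise_atom : _ -> measurableTypeR R)
    (fun i : 'I_(M + M.+1) => sqr_ge0 (tent_root M i)) (sum_tent_root M_gt0).

Let M_gt0R : 0 < M%:R :> R. Proof. by rewrite ltr0n. Qed.

Lemma gap_gt0 : 0 < gap :> R.
Proof. by rewrite invr_gt0 mulr_gt0. Qed.

Lemma gapM : M%:R * gap = 1 / 4 :> R.
Proof. by rewrite /gap; field; rewrite gt_eqF. Qed.

Lemma gap_le : gap <= 1 / 4 :> R.
Proof.
rewrite -gapM -[leLHS]mul1r; apply: ler_wpM2r; first exact: ltW gap_gt0.
by rewrite ler1n.
Qed.

Lemma noise_atom_inj : injective (@noise_atom R).
Proof.
move=> i j /(mulIf _) h; apply/val_inj/eqP; rewrite -(eqr_nat R); apply/eqP.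
by apply: (addIr (- M%:R)); apply: h; rewrite gt_eqF// mulr_gt0// gap_gt0.
Qed.

Lemma noise_subgaussian : subgaussian1 noise.
Proof.
have rev_natr (i : 'I_(M + M.+1)) : (rev_ord i)%:R = 2 * M%:R - i%:R :> R.
  have h : (rev_ord i + i = M + M)%nat by rewrite /=; have := ltn_ord i; lia.
  by move/(congr1 (fun k => k%:R : R)): h; rewrite !natrD; lra.
apply: (@subgaussian1_symmetric _ _ _ (@rev_ord _)).
- exact: rev_ordK.
- by move=> i; rewrite tent_root_sym.
- by move=> i; rewrite /noise_atom rev_natr; ring.
- move=> i; rewrite /noise_atom normrM [X in _ * X]gtr0_norm; last first.
    by rewrite mulr_gt0// gap_gt0.
  have -> : 1 / 2 = M%:R * (2 * gap) :> R.
    by rewrite mulrCA gapM; field.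
  rewrite ler_wpM2r//; first by rewrite ltW// mulr_gt0// gap_gt0.
  have h : (i%:R : R) <= M%:R + M%:R by rewrite -natrD ler_nat; have := ltn_ord i; lia.
  have i0 : 0 <= i%:R :> R by [].
  by rewrite ler_norml; lra.
Qed.

Lemma valid_hard_instance tau :
  valid_instance (reward tau) (unif S) (fun=> unif A) noise.
Proof.
have g0 := gap_gt0; have g1 := gap_le.
have unif1 n : (0 < n)%nat -> \sum_(i < n) unif n i = 1.
  by move=> n0; rewrite sumr_const card_ord -[LHS]mulr_natr mulVf// pnatr_eq0 -lt0n.
split; first by move=> s a; rewrite /reward; case: ifP => _; lra.
split; first by split => [s|]; [rewrite invr_ge0|exact: unif1].
split; last exact: noise_subgaussian.
split; first by split => [s a|s]; [rewrite invr_ge0|exact: unif1].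
by move=> s a; rewrite invr_gt0 ltr0n.
Qed.

(** A positive sign shifts the index by one, because [2 * gap] is both the lattice step and the
    difference of the means. The end point left over carries no mass. *)
Lemma lattice_step tau s a (G : R -> R) :
  \sum_(i < (M + M.+1).+1) root M tau (s, a, i) ^+ 2 * G (lattice i) =
  unif S s * unif A a *
  \sum_(i < M + M.+1) tent_root M i ^+ 2 * G (reward tau s a + noise_atom i).
Proof.
under eq_bigr do rewrite /root exprMn sqr_sqrtr ?mulr_ge0 ?invr_ge0// -mulrA.
rewrite -mulr_sumr; congr (_ * _); rewrite /reward /=.
case: (sgn tau s a).
  rewrite big_ord_recl/= tent_root_pred0 expr0n/= mul0r add0r.
  apply: eq_bigr => i _; congr (_ * G _).
  by rewrite /lattice /noise_atom /bump/= add1n -natr1; ring.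
rewrite big_ord_recr/= tent_root_last// expr0n/= mul0r addr0.
by apply: eq_bigr => i _; congr (_ * G _).
Qed.

(** One inequality suffices for a lower bound; it follows sample by sample from
    [integral_discrete_law_ge], the induction hypothesis bounding the inner integrand pointwise. *)
Lemma data_expect_hard_ge tau k (F : seq (sample S A) -> R) :
  (forall D, size D = k -> 0 <= F D) ->
  ((finite_expect observation (root M tau) k F)%:E <=
   data_expect (reward tau) (unif S) (fun=> unif A) noise k (fun D => (F D)%:E))%E.
Proof.
elim: k F => [//|k IH] F F0 /=.
rewrite -(pair_bigA _ (fun sa i => root M tau (sa, i) ^+ 2 *
  finite_expect observation (root M tau) k (fun D => F (observation (sa, i) :: D))))/=.
rewrite -(pair_bigA _ (fun s a => \sum_i root M tau (s, a, i) ^+ 2 *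
  finite_expect observation (root M tau) k (fun D => F (observation (s, a, i) :: D))))/=.
rewrite -sumEFin; apply: lee_sum => s _; rewrite -sumEFin; apply: lee_sum => a _.
pose G (y : R) := finite_expect observation (root M tau) k (fun D => F ((s, a, y) :: D)).
have F0' y D : size D = k -> 0 <= F ((s, a, y) :: D) by move=> sD; apply: F0; rewrite /= sD.
have G0 y : 0 <= G y by apply: finite_expect_ge0 => D /F0'.
rewrite (lattice_step tau s a G) EFinM; apply: lee_wpmul2l.
  by rewrite lee_fin mulr_ge0// invr_ge0.
apply: (@integral_discrete_law_ge _ (measurableTypeR R) R _ noise_atom _
  (fun i : 'I_(M + M.+1) => sqr_ge0 (tent_root M i)) (sum_tent_root M_gt0)
  (fun e => G (reward tau s a + e))
  (fun e => data_expect (reward tau) (unif S) (fun=> unif A) noise k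
      (fun D => (F ((s, a, reward tau s a + e) :: D))%:E))).
- exact: noise_atom_inj.
- by move=> i; exact: measurable_set1.
- by move=> x; exact: G0.
- by move=> x; apply: IH => D /F0'.
Qed.

End HardInstances.

Arguments observation {S A} M z.

(** * Assouad's argument *)

Lemma exists_ge_average (R : realType) (T : finType) (t0 : T) (f : T -> R) (v : R) :
  #|T|%:R * v <= \sum_t f t -> exists t, v <= f t.
Proof.
move=> h; apply: contrapT => /forallNP n; move: h; apply/negP; rewrite -ltNge.
rewrite mulr_natl -sumr_const; apply: ltr_sum.
  by apply/hasP; exists t0; rewrite ?mem_index_enum.
by move=> t _; rewrite ltNge; apply/negP/n.
Qed.

Section Assouad.
Context {S A : nat} (M n : nat) (eta : R).
Context (S_gt0 : (0 < S)%nat) (A_gt0 : (0 < A)%nat) (M_gt0 : (0 < M)%nat).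
Context (A_even : ~~ odd A) (eta_gt0 : 0 < eta).
Context (n_small : 12 * n%:R <= M%:R ^+ 2 * S%:R * A%:R :> R).
(** With [u = eta * gap M], [L_eq] is [1 / (L - u) + 1 / (L + u) = 2] cleared of denominators: the
    normalization of the optimal policy. *)
Context (L : R) (L_eq : L ^+ 2 = L + (eta * gap M) ^+ 2) (L_gt : eta * gap M < L).
Context (est : seq (sample S A) -> policy S A).
Context (est_fs : forall D, size D = n -> full_support (est D)).
Implicit Types (tau : {ffun 'I_S * 'I_A -> bool}).

Let u := eta * gap M.

Let u_gt0 : 0 < u. Proof. by rewrite mulr_gt0// gap_gt0. Qed.
Let L_gt0 : 0 < L. Proof. exact: lt_trans u_gt0 L_gt. Qed.
Let S_gt0R : 0 < S%:R :> R. Proof. by rewrite ltr0n. Qed.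
Let A_gt0R : 0 < A%:R :> R. Proof. by rewrite ltr0n. Qed.
Let M_gt0R : 0 < M%:R :> R. Proof. by rewrite ltr0n. Qed.

Let slope (b : bool) := if b then L - u else L + u.

Let slope_gt0 b : 0 < slope b.
Proof. by case: b; rewrite /slope; move: u_gt0 L_gt0 L_gt; rewrite -/u; lra. Qed.

(** Adding the sum to its image under [rev_ord] pairs opposite signs; the two slopes have sum [2 L]
    and, by [L_eq], product [L]. *)
Let sum_slope tau s : \sum_a (A%:R * slope (sgn tau s a))^-1 = 1.
Proof.
set X := \sum_a _.
have XX : X + X = 2.
  rewrite {2}/X (reindex_inj rev_ord_inj)/= -big_split/=.
  rewrite (eq_bigr (fun=> A%:R^-1 * 2)) => [|a _].
    by rewrite sumr_const card_ord -[LHS]mulr_natr; field; rewrite gt_eqF.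
  rewrite sgn_rev//.
  have -> : (A%:R * slope (sgn tau s a))^-1 + (A%:R * slope (~~ sgn tau s a))^-1
      = (A%:R * slope true)^-1 + (A%:R * slope false)^-1.
    by case: (sgn tau s a) => //=; rewrite addrC.
  have t0 := slope_gt0 true; have f0 := slope_gt0 false.
  have e : slope true * slope false = L.
    by rewrite /slope; have := L_eq; rewrite -/u; nra.
  have -> : (A%:R * slope true)^-1 + (A%:R * slope false)^-1 =
      A%:R^-1 * ((slope true + slope false) / (slope true * slope false)).
    by field; rewrite !gt_eqF.
  by rewrite e /slope; field; rewrite !gt_eqF.
lra.
Qed.

Let rewardE tau s a :
  reward M tau s a = (1 / 2 + L / eta) - slope (sgn tau s a) / eta.
Proof.
rewrite /reward /slope /u; case: (sgn tau s a); field; rewrite ?gt_eqF//.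
Qed.

Let loss (b : bool) (s : 'I_S) (a : 'I_A) (D : seq (sample S A)) : R :=
  phi (A%:R * est D s a * slope b).

Let loss_ge0 b s a D : size D = n -> 0 <= loss b s a D.
Proof. by move=> /est_fs[_ h]; apply: phi_ge0; rewrite !mulr_gt0. Qed.

Let SubOptE tau D : size D = n ->
  SubOpt eta (reward M tau) (unif S) (fun=> unif A) (est D) =
  (eta * S%:R * A%:R)^-1 * \sum_s \sum_a loss (sgn tau s a) s a D.
Proof.
move=> sD.
by rewrite (@SubOpt_uniform S A S_gt0 A_gt0 eta (1 / 2 + L / eta) eta_gt0
  (fun s a => slope (sgn tau s a)))//; exact: est_fs.
Qed.

Lemma hard_SubOpt_ge0 tau D : size D = n ->
  0 <= SubOpt eta (reward M tau) (unif S) (fun=> unif A) (est D).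
Proof.
move=> sD; rewrite SubOptE// mulr_ge0 ?invr_ge0 ?mulr_ge0//; first exact: ltW.
by apply: sumr_ge0 => s _; apply: sumr_ge0 => a _; exact: loss_ge0.
Qed.

(** By Bernoulli, [n] samples lose at most [n * x], which [n_small] bounds by [1 / 4]. The case
    [n = 0] is separate because [x <= 1] is drawn from [n >= 1]. *)
Let affinity_large tau s a :
  3 / 4 <= (\sum_z root M tau z * root M (flip s a tau) z) ^+ n :> R.
Proof.
set x := 3 / (M%:R ^+ 2 * S%:R * (A%:R : R)).
have d0 : 0 < M%:R ^+ 2 * S%:R * A%:R :> R by rewrite !mulr_gt0// exprn_gt0.
have d3 : (3 <= M%:R ^+ 2 * S%:R * A%:R :> R) \/ n = 0%nat.
  have [->|n0] := eqVneq n 0%nat; [by right|left].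
  have : 1 <= n%:R :> R by rewrite ler1n lt0n.
  by move: n_small; lra.
case: d3 => [d3|->]; last by rewrite expr0; lra.
have x01 : 0 <= x <= 1.
  by rewrite /x divr_ge0 ?(ltW d0)//= ler_pdivrMr// mul1r.
have nx : n%:R * x <= 1 / 4.
  by rewrite /x mulrA ler_pdivrMr//; move: n_small; lra.
have := @root_affinity R _ _ _ S_gt0 A_gt0 M_gt0 tau s a; rewrite -/x => aff.
apply: (@le_trans _ _ ((1 - x) ^+ n)).
  by have := bernoulli_ineq n x01; lra.
by rewrite lerXn2r// nnegrE; move: x01 aff => /andP[]; lra.
Qed.

(** [hellinger_two_point] at [a = b = 1]: the factor [1 / 4] is the affinity bound [3 / 4] minus
    [(1 + 1) / 4]. *)
Let flip_bound tau s a :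
  u ^+ 2 / L ^+ 2 / 4 <=
  finite_expect (observation M) (root M tau) n (loss (sgn tau s a) s a) +
  finite_expect (observation M) (root M (flip s a tau)) n
    (loss (sgn (flip s a tau) s a) s a).
Proof.
set d := u ^+ 2 / L ^+ 2.
have d0 : 0 <= d by rewrite divr_ge0// sqr_ge0.
have := @hellinger_two_point R _ _ (@observation S A M) (root M tau) (root M (flip s a tau))
  d 1 1 n (loss (sgn tau s a) s a) (loss (sgn (flip s a tau) s a) s a)
  (sum_sqr_root S_gt0 A_gt0 M_gt0 _) (sum_sqr_root S_gt0 A_gt0 M_gt0 _) d0.
rewrite !expr1n !mul1r => H.
apply: le_trans (H _); first by have := affinity_large tau s a; nra.
move=> D sD; split; [exact: loss_ge0|exact: loss_ge0|].
rewrite sgn_flip_self//.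
have [_ est_gt0] := est_fs sD.
have t0 : 0 < A%:R * est D s a by rewrite mulr_gt0.
have uL : 0 <= u < L by rewrite ltW//=; exact: L_gt.
have := two_point_separation t0 L_gt0 uL; rewrite -/d /loss /slope /phi.
by case: (sgn tau s a) => //=; rewrite addrC.
Qed.

(** Average over all [tau]. In each cell, reindexing by [flip] pairs every pattern with its
    neighbour, so twice the mean loss is at least a quarter of the separation; the [S A] cells
    cancel the normalization. *)
Lemma assouad_lower_bound : exists tau,
  u ^+ 2 / L ^+ 2 / (8 * eta) <=
  finite_expect (observation M) (root M tau) n
    (fun D => SubOpt eta (reward M tau) (unif S) (fun=> unif A) (est D)).
Proof.
apply: (exists_ge_average [ffun=> true]).
set d := u ^+ 2 / L ^+ 2.
rewrite (eq_bigr (fun tau => (eta * S%:R * A%:R)^-1 * \sum_s \sum_a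
    finite_expect (observation M) (root M tau) n (loss (sgn tau s a) s a))); last first.
  move=> tau _; rewrite (eq_finite_expect _ _ (SubOptE tau)) finite_expectZ.
  rewrite finite_expect_sum; congr (_ * _); apply: eq_bigr => s _.
  by rewrite finite_expect_sum.
rewrite -mulr_sumr exchange_big/=.
under eq_bigr do rewrite exchange_big/=.
set N : R := #|_|%:R.
have cell s a : N * (d / 8) <= \sum_tau
    finite_expect (observation M) (root M tau) n (loss (sgn tau s a) s a).
  set f := fun tau : {ffun 'I_S * 'I_A -> bool} =>
    finite_expect (observation M) (root M tau) n (loss (sgn tau s a) s a).
  have e : \sum_tau f tau = \sum_tau f (flip s a tau).
    by rewrite (reindex_inj (can_inj (flipK s a))).
  have : N * (d / 4) <= \sum_tau f tau + \sum_tau f (flip s a tau).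
    rewrite -big_split/= mulr_natl -sumr_const; apply: ler_sum => tau _.
    exact: flip_bound.
  by rewrite -e; lra.
apply: (@le_trans _ _ ((eta * S%:R * A%:R)^-1 * \sum_(s < S) \sum_(a < A) N * (d / 8))).
  rewrite !(sumr_const, card_ord) -mulrnA -[X in _ <= _ * X]mulr_natr natrM.
  rewrite le_eqVlt; apply/orP; left; apply/eqP.
  by field; rewrite !gt_eqF.
rewrite ler_wpM2l//; first by rewrite invr_ge0 !mulr_ge0// ltW.
by apply: ler_sum => s _; apply: ler_sum => a _; exact: cell.
Qed.

End Assouad.

(** * Choice of the lattice size and of the multiplier *)

Theorem theorem4p1 :
  exists c : R, 0 < c /\
  forall (A S : nat) (eta : R) (n : nat),
    ~~ odd A -> (2 <= A)%nat -> (1 <= S)%nat -> 0 < eta ->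
    (16 * S * A < n)%nat /\ 4 * eta ^+ 2 * S%:R * A%:R < n%:R ->
    forall est : seq (sample S A) -> policy S A,
      valid_estimator n est ->
      ((c * (eta * S%:R * A%:R / n%:R))%:E <=
       ereal_sup [set v : \bar R |
                   exists (r : 'I_S -> 'I_A -> R) (rho : 'I_S -> R)
                          (piref : policy S A) (nu : probability (measurableTypeR R) R),
                     valid_instance r rho piref nu /\
                     v = expected_subopt eta n est r rho piref nu])%E.
Proof.
(* [512 = 16 * 4 * 8] comes from [gap ^+ 2], from [L <= 2] and from [assouad_lower_bound];
   [48 = 4 * 12] from the upper bound on [M ^+ 2]. *)
exists ((512 * 48)^-1); split; first by rewrite invr_gt0 mulr_gt0 ?ltr0n.
move=> A S eta n A_even A2 S_gt0 eta_gt0 [n_big eta_small] est [est_fs _].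
have A_gt0 : (0 < A)%nat by lia.
have S_gt0R : 0 < S%:R :> R by rewrite ltr0n.
have A_gt0R : 0 < A%:R :> R by rewrite ltr0n.
have SA_gt0 : 0 < S%:R * A%:R :> R by exact: mulr_gt0.
have nSA : 16 * (S%:R * A%:R) <= n%:R :> R.
  by rewrite -!natrM ler_nat mulnA ltnW.
have n_gt0 : 0 < n%:R :> R by lra.
(* The smallest value of [M ^+ 2] allowed by [n_small]. *)
pose x := 12 * (n%:R : R) / (S%:R * A%:R).
have x1 : 1 <= x by rewrite ler_pdivlMr// mul1r; lra.
have [M M_gt0 /andP[xM Mx]] := nat_square_between x1.
have M_gt0R : 0 < M%:R :> R by rewrite ltr0n.
have n_small : 12 * n%:R <= M%:R ^+ 2 * S%:R * A%:R :> R.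
  by move: xM; rewrite ler_pdivrMr// mulrA.
have M_le : M%:R ^+ 2 * (S%:R * A%:R) <= 48 * n%:R :> R.
  have := ler_wpM2r (ltW SA_gt0) Mx.
  have e : x * (S%:R * A%:R) = 12 * n%:R by rewrite /x divfK// gt_eqF.
  by rewrite -[4 * x * _]mulrA e; lra.
pose u := eta * gap M.
have u_gt0 : 0 < u by rewrite mulr_gt0// gap_gt0.
have u2E : u ^+ 2 * (16 * M%:R ^+ 2) = eta ^+ 2.
  by rewrite /u /gap; field; rewrite gt_eqF.
(* [eta_small] makes [eta ^+ 2 * S * A] less than [n / 4], while [16 * M ^+ 2 * S * A] is at least
   [192 * n]. *)
have u_lt1 : u < 1.
  rewrite -(@expr_lt1 _ 2) ?ltW//.
  have p2 : 0 < 16 * M%:R ^+ 2 * (S%:R * A%:R) :> R by rewrite !mulr_gt0// exprn_gt0.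
  rewrite -(ltr_pM2r p2) mul1r.
  have -> : u ^+ 2 * (16 * M%:R ^+ 2 * (S%:R * A%:R)) = eta ^+ 2 * (S%:R * A%:R).
    by rewrite -u2E; ring.
  by move: eta_small n_small; rewrite -!mulrA; lra.
(* [L] is the positive root of [L ^+ 2 = L + u ^+ 2]; [u < 1] keeps it between [1] and [2]. *)
pose q := Num.sqrt (1 + 4 * u ^+ 2); pose L := (1 + q) / 2.
have q2 : q ^+ 2 = 1 + 4 * u ^+ 2.
  by rewrite sqr_sqrtr//; have := sqr_ge0 u; lra.
have q_ge0 : 0 <= q by exact: sqrtr_ge0.
have q_ge1 : 1 <= q by have := sqr_ge0 u; nra.
have q_le3 : q <= 3 by nra.
have L_eq : L ^+ 2 = L + u ^+ 2 by rewrite /L; nra.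
have L_gt : u < L by rewrite /L; lra.
have L_gt0 : 0 < L by lra.
have [tau tau_ge] := assouad_lower_bound S_gt0 A_gt0 M_gt0 A_even eta_gt0 n_small
  L_eq L_gt est_fs.
apply: (@le_trans _ _ (expected_subopt eta n est (reward M tau) (unif S)
  (fun=> unif A) (noise M_gt0))); last first.
  apply: ereal_sup_ubound; exists (reward M tau), (unif S), (fun=> unif A), (noise M_gt0).
  by split => //; exact: valid_hard_instance.
apply: le_trans (data_expect_hard_ge M_gt0 tau _); last first.
  by move=> D; apply: (hard_SubOpt_ge0 _ _ _ _ _ L_eq L_gt).
rewrite lee_fin; apply: le_trans tau_ge; rewrite -/u.
have L_le2 : L <= 2 by rewrite /L; lra.
apply: (@le_trans _ _ (u ^+ 2 / 4 / (8 * eta))); last first.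
  rewrite ler_wpM2r ?invr_ge0 ?mulr_ge0 ?(ltW eta_gt0)// ler_wpM2l ?sqr_ge0//.
  by rewrite lef_pV2 ?posrE ?exprn_gt0//; nra.
have -> : u ^+ 2 / 4 / (8 * eta) = eta / (512 * M%:R ^+ 2).
  by rewrite /u /gap; field; rewrite !gt_eqF.
rewrite ler_pdivlMr; last by rewrite mulr_gt0 ?exprn_gt0 ?ltr0n.
have -> : (512 * 48)^-1 * (eta * S%:R * A%:R / n%:R) * (512 * M%:R ^+ 2) =
    eta * (M%:R ^+ 2 * (S%:R * A%:R) / (48 * n%:R)).
  by field; rewrite gt_eqF.
by rewrite ger_pMr// ler_pdivrMr ?mulr_gt0// mul1r.
Qed.
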